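(* Let $f_1,f_2$ be power spectral density functions with $\log f_1,\log f_2\in L_1[-\pi,\pi)$. If the one-step-ahead predictor is based on $f_2$ (i.e. is optimal for $f_2$) whereas the underlying process has $f_1$ as its spectral density, then the variance of the prediction error is $$\frac{1}{2\pi}\int_{-\pi}^{\pi}|a_{f_2}(e^{j\theta})|^2f_1(\theta)\,d\theta=\left(\frac{1}{2\pi}\int_{-\pi}^{\pi}\frac{f_1(\theta)}{f_2(\theta)}\,d\theta\right)g_{f_2}.$$ Dividing this variance by the optimal value $g_{f_1}$ gives $$\rho_{a/g}(f_1,f_2):=\left(\frac{1}{2\pi}\int_{-\pi}^{\pi}\frac{f_1(\theta)}{f_2(\theta)}\,d\theta\right)\frac{g_{f_2}}{g_{f_1}}=\left(\frac{1}{2\pi}\int_{-\pi}^{\pi}\frac{f_1(\theta)}{f_2(\theta)}\,d\theta\right)\frac{1}{\exp\left(\frac{1}{2\pi}\int_{-\pi}^{\pi}\log\left(\frac{f_1(\theta)}{f_2(\theta)}\right)d\theta\right)},$$ which is the ratio of the arithmetic mean over the geometric mean of the fraction $f_1/f_2$ of the two spectral density functions.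
   Context: Here $j=\sqrt{-1}$, and a power spectral density function is a nonnegative integrable function on $[-\pi,\pi)$, the density of the power spectrum of a scalar zero-mean stationary random process $\{u_k,\ k\in\mathbb{Z}\}$. If $\log f\in L_1[-\pi,\pi)$, set $g_f:=\exp\left(\frac{1}{2\pi}\int_{-\pi}^{\pi}\log f(\theta)\,d\theta\right)$, the geometric mean of $f$; it is the least one-step-ahead prediction error variance for spectral density $f$. In this case $f(\theta)=g_f/|a_f(e^{j\theta})|^2$, where $a_f(z)=1+a_1z+a_2z^2+\dots$ is an outer function in the Hardy space $H_2(\mathbb{D})$ of the unit disc $\mathbb{D}=\{z:|z|<1\}$, normalized by $a_f(0)=1$ (i.e. it is analytic in $\mathbb{D}$ and its radial limits are square integrable). The $f$-optimal predictor of $u_0$ based on past observations is $\hat u_{0|{\rm past}}=\sum_{k>0}(-a_k)u_{-k}$. For a process with spectral density $h$, the error variance of a predictor $\sum_{k>0}\alpha_ku_{-k}$ of $u_0$ is $\frac{1}{2\pi}\int_{-\pi}^{\pi}\left|1-\sum_{k>0}\alpha_ke^{jk\theta}\right|^2h(\theta)\,d\theta$. *)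

(* Defs.v *)
From HB Require Import structures.
From mathcomp Require Import all_boot all_order all_algebra.
From mathcomp Require Import all_classical all_reals all_analysis.
From mathcomp Require Import complex.

Set Implicit Arguments.
Unset Strict Implicit.
Unset Printing Implicit Defensive.

Import Order.TTheory GRing.Theory Num.Theory.
Import numFieldNormedType.Exports.

Local Open Scope classical_set_scope.
Local Open Scope ring_scope.
Local Open Scope complex_scope.

Section PredictionDefs.
Context {R : realType}.
Implicit Types (f h : R -> R) (a alpha : nat -> R[i]) (F : R[i] -> R[i]).

Local Notation mu := (@lebesgue_measure R).

Definition period : set R := `[- pi, pi[%classic.

(* Extended-real valued: the mean of a nonnegative function may be +oo. *)
Definition mean (h : R -> \bar R) : \bar R :=
  (((2 * pi)^-1)%:E * \int[mu]_(theta in period) h theta)%E.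

Definition psd f : Prop :=
  (forall theta, theta \in period -> 0 <= f theta) /\
  mu.-integrable period (EFin \o f).

(* [lne] rather than [ln], because [ln 0 = 0] while [lne 0 = -oo]: as in the
   usual reading, log-integrability forces f > 0 almost everywhere. *)
Definition log_integrable f : Prop :=
  mu.-integrable period (fun theta => lne (f theta)%:E).

Definition arith_mean f : \bar R := mean (fun theta => (f theta)%:E).

Definition geom_mean f : \bar R :=
  expeR (mean (fun theta => lne (f theta)%:E)).

Definition cexp (z : R[i]) : R[i] :=
  (expR (complex.Re z))%:C * (cos (complex.Im z) +i* sin (complex.Im z)).

Definition ejt (theta : R) : R[i] := cos theta +i* sin theta.

Definition sqnorm (z : R[i]) : R := complex.Re z ^+ 2 + complex.Im z ^+ 2.

Definition cmean (G : R -> R[i]) : R[i] :=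
  ((2 * pi)^-1 * \int[mu]_(theta in period) complex.Re (G theta))%R +i*
  ((2 * pi)^-1 * \int[mu]_(theta in period) complex.Im (G theta))%R.

(* R[i] has its topology as a numFieldType, hence the casts below. *)
Local Notation C := (R[i] : numFieldType).

(* Partial sums of the power series with coefficients a, from degree m on. *)
Definition psum m a (z : R[i]) (n : nat) : C := \sum_(m <= k < n) a k * z ^+ k.

Definition powser m a (z : R[i]) : R[i] := lim (psum m a z n @[n --> \oo]).

Definition analytic_on_disc a : Prop :=
  forall z : R[i], `|z| < 1 -> cvg (psum 0 a z n @[n --> \oo]).

Definition radial F (theta : R) (r : R) : C := F (r%:C * ejt theta).

Definition has_radial_limit F (theta : R) : Prop :=
  cvg (radial F theta r @[r --> 1^'-]).

(* The boundary value F(e^{j theta}), i.e. the radial limit. *)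
Definition boundary F (theta : R) : R[i] :=
  lim (radial F theta r @[r --> 1^'-]).

(* Outer functions:
   c exp (1/(2 pi) int (e^{jt} + z) / (e^{jt} - z) log phi(t) dt) on the disc,
   with |c| = 1, phi > 0 and log phi integrable. *)
Definition outer F : Prop :=
  exists (c : R[i]) (phi : R -> R),
    [/\ `|c| = 1,
        forall t, t \in period -> 0 < phi t,
        mu.-integrable period (fun t => (ln (phi t))%:E) &
        forall z : R[i], `|z| < 1 ->
          F z = c * cexp (cmean (fun t =>
            (ejt t + z) / (ejt t - z) * (ln (phi t))%:C))].

(* [a] is the coefficient sequence of the function a_f.  Square integrability
   of the boundary values (membership in H_2) is equivalent to integrability
   of 1/f, which does not follow from that of log f; it is not imposed, so
   that every f with log f integrable is covered. *)
Definition outer_factor f a : Prop :=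
  [/\ analytic_on_disc a,
      outer (powser 0 a),
      a 0%N = 1 &
      {ae mu, forall theta, theta \in period ->
         has_radial_limit (powser 0 a) theta /\
         (f theta)%:E =
           (geom_mean f / (sqnorm (boundary (powser 0 a) theta))%:E)%E}].

(* A predictor sum_{k > 0} alpha_k u_{-k} is given by its coefficients alpha;
   alpha 0 is irrelevant. *)
Definition optimal_predictor a : nat -> R[i] := fun k => - a k.

(* Error variance of the predictor alpha for spectral density h; the series
   sum_{k > 0} alpha_k e^{jk theta} is the boundary value of the power series
   with these coefficients. *)
Definition error_variance h alpha : \bar R :=
  mean (fun theta =>
    (sqnorm (1 - boundary (powser 1 alpha) theta) * h theta)%:E).

Definition rho_ag f1 f2 : \bar R :=
  (arith_mean (fun theta => (f1 theta / f2 theta)%R)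
   * (geom_mean f2 / geom_mean f1))%E.

End PredictionDefs.

(* Main.v *)
Require Import Defs.
From mathcomp Require Import all_boot all_order all_algebra.
From mathcomp Require Import all_classical all_reals all_analysis.
From mathcomp Require Import complex measurable_realfun.

(** On the unit circle the predictor's error filter [1 - sum_{k > 0} (- a_k) z^k]
    is [a_f2], and [|a_f2|^2 = g_f2 / f2] almost everywhere: the error variance
    is [g_f2] times the mean of [f1 / f2].  The rest is additivity of the mean of
    the logarithm.  Boundary values are not known to be measurable, hence the
    need for an almost everywhere replacement rule without measurability. *)

Set Implicit Arguments.
Unset Strict Implicit.
Unset Printing Implicit Defensive.

Import Order.TTheory GRing.Theory Num.Theory.
Import numFieldNormedType.Exports.
Local Open Scope classical_set_scope.
Local Open Scope ring_scope.

Section AlmostEverywhereIntegral.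
Local Open Scope ereal_scope.
Context d (T : measurableType d) (R : realType).
Variable mu : {measure set T -> \bar R}.
Import HBNNSimple.

(** Simple functions are measurable, so the usual almost everywhere rule applies to them; this lets
    a simple minorant be set to zero on an exceptional null set at no cost. *)
Lemma sintegral_proj_null (N : set T) (mN : measurable N)
    (h : {nnsfun T >-> R}) :
  mu N = 0 -> sintegral mu (proj_nnsfun h (measurableC mN)) = sintegral mu h.
Proof.
move=> N0; rewrite -!integralT_nnsfun.
apply: ge0_ae_eq_integral => //.
- by apply/measurable_EFinP.
- by apply/measurable_EFinP.
- by move=> x _; rewrite lee_fin.
- by move=> x _; rewrite lee_fin.
exists N; split => // x /= /not_implyP[_ hx].
apply: contrapT => Nx; apply: hx.
by rewrite mindicE mem_set// mulr1.
Qed.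

(** A simple function below [f], once set to zero on the null set where [f] and [g] may differ, lies
    below [g] and keeps its integral; hence the supremum for [g] is at least that for [f]. *)
Lemma ge0_le_integral_ae_eq (D : set T) (f g : T -> \bar R) :
  (forall x, D x -> 0 <= f x) -> (forall x, D x -> 0 <= g x) ->
  ae_eq mu D f g -> \int[mu]_(x in D) f x <= \int[mu]_(x in D) g x.
Proof.
move=> f0 g0 [N [mN N0 subN]]; rewrite !ge0_integralE//.
apply: ge_ereal_sup => _ [h /= hf <-].
rewrite -(sintegral_proj_null mN h N0).
apply: ereal_sup_ubound; exists (proj_nnsfun h (measurableC mN)) => //= x.
rewrite mindicE; have [xN|xN] := boolP (x \in ~` N); last first.
  by rewrite mulr0; apply: erestrict_ge0.
rewrite mulr1 (le_trans (hf x))// !patchE; case: ifPn => // xD.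
suff -> : f x = g x by [].
(* [N] covers every point of [D] where [f] and [g] differ, and [x] lies outside [N]. *)
apply: contrapT => fg; move/set_mem: xN; apply; apply: subN => /= H.
by apply: fg; apply: H; exact: set_mem.
Qed.

(* No measurability is needed because the integral of a nonnegative function
   is the supremum over the simple functions below it, a lower integral. *)
Lemma integral_ae_eq_nonmeasurable (D : set T) (f g : T -> \bar R) :
  ae_eq mu D f g -> \int[mu]_(x in D) f x = \int[mu]_(x in D) g x.
Proof.
move=> /ae_eq_funeposneg[fgp fgn].
rewrite integralE [RHS]integralE; congr (_ - _); apply/eqP;
  rewrite eq_le !ge0_le_integral_ae_eq//; exact: ae_eq_sym.
Qed.

End AlmostEverywhereIntegral.

Section Boundary.

(** Stated for a general filter because it serves both limits behind a boundary value: partial sums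
    as [n --> \oo] and the radial limit as [r --> 1^'-]. *)
Lemma lim_near_subr (K : numFieldType) (T : Type) (F : set_system T)
    (FF : ProperFilter F) (c : K) (u v : T -> K) :
  cvg (u x @[x --> F]) -> (\forall x \near F, v x = c - u x) ->
  lim (v x @[x --> F]) = c - lim (u x @[x --> F]).
Proof.
move=> cvu vE; apply: cvg_lim; first exact: norm_hausdorff.
have : (c - u x) @[x --> F] --> c - lim (u x @[x --> F]).
  by apply: cvgB => //; exact: cvg_cst.
by apply: cvg_trans; apply: near_eq_cvg; apply: filterS vE => x /= ->.
Qed.

Context {R : realType}.
Local Notation C := (R[i] : numFieldType).

Lemma powser_optimal_predictor (a : nat -> R[i]) (z : R[i]) :
  analytic_on_disc a -> a 0%N = 1 -> `|z| < 1 ->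
  powser 1 (optimal_predictor a) z = 1 - powser 0 a z.
Proof.
move=> ana a0 z1; apply: (@lim_near_subr C); first exact: ana.
(* At [n = 0] both partial sums are empty and the identity would read 0 = 1 - 0; from [n = 1] on,
   the term [a 0 = 1] cancels the constant. *)
exists 1%N => // n /= n1.
rewrite /psum [in RHS]big_ltn// a0 expr0 mulr1 opprD addrA subrr add0r -sumrN.
by apply: eq_bigr => k _; rewrite /optimal_predictor mulNr.
Qed.

Lemma normr_ejt (theta : R) : `|ejt theta| = 1.
Proof. by rewrite normc_def /= cos2Dsin2 sqrtr1. Qed.

Lemma boundary_optimal_predictor (a : nat -> R[i]) (theta : R) :
  analytic_on_disc a -> a 0%N = 1 -> has_radial_limit (powser 0 a) theta ->
  1 - boundary (powser 1 (optimal_predictor a)) theta =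
  boundary (powser 0 a) theta.
Proof.
move=> ana a0 rad.
suff -> : boundary (powser 1 (optimal_predictor a)) theta =
    1 - boundary (powser 0 a) theta by rewrite subKr.
apply: (@lim_near_subr C); first exact: rad.
(* For [0 < r < 1] the point [r e^{j theta}] lies in the open disc, where the power series identity
   holds. *)
near=> r; rewrite /radial powser_optimal_predictor// normrM normr_ejt mulr1.
have r0 : 0 < r by near: r; exact: nbhs_left_gt.
rewrite ger0_norm ?lecR ?ltcR ?ltW//; near: r; exact: nbhs_left_lt.
Unshelve. all: by end_near. Qed.

End Boundary.

Section Means.
Context {R : realType}.
Local Notation mu := (@lebesgue_measure R).
Implicit Types f : R -> R.

Lemma measurable_period : measurable (@period R : set (measurableTypeR R)).
Proof. exact: measurable_itv. Qed.

Lemma mean_ae_eq (h k : R -> \bar R) : ae_eq mu period h k -> mean h = mean k.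
Proof. by move=> hk; rewrite /mean (integral_ae_eq_nonmeasurable hk). Qed.

Lemma mean_fin_num (h : R -> \bar R) :
  mu.-integrable period h -> mean h \is a fin_num.
Proof.
by move=> ih; rewrite fin_numM// integrable_fin_num//; exact: measurable_period.
Qed.

(** An integrable function is finite almost everywhere, whereas [lne] is [-oo] at nonpositive
    reals. *)
Lemma log_integrable_gt0 f : log_integrable f ->
  {ae mu, forall t, period t -> 0 < f t}.
Proof.
move=> lf; have := integrable_ae measurable_period lf.
apply: filterS => t /= H /H.
by case: ifPn => //; rewrite -ltNge.
Qed.

(** Exhibits the geometric mean as a positive real, so that products and inverses of such means
    follow field rules. *)
Lemma geom_meanE f : log_integrable f ->
  geom_mean f = (expR (fine (mean (fun t => lne (f t)%:E))))%:E.
Proof. by move=> lf; rewrite /geom_mean -[X in expeR X]fineK// mean_fin_num. Qed.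

Lemma mean_lne_div f1 f2 : log_integrable f1 -> log_integrable f2 ->
  mean (fun t => lne (f1 t / f2 t)%:E) =
  (mean (fun t => lne (f1 t)%:E) - mean (fun t => lne (f2 t)%:E))%E.
Proof.
move=> lf1 lf2.
have -> : mean (fun t => lne (f1 t / f2 t)%:E) =
    mean ((fun t => lne (f1 t)%:E) \- (fun t => lne (f2 t)%:E))%E.
  apply: mean_ae_eq.
  apply: (filterS2 (ae_filter_ringOfSetsType mu) _
    (log_integrable_gt0 lf1) (log_integrable_gt0 lf2)) =>
      t + + pt => /(_ pt) p1 /(_ pt) p2.
  by rewrite !lne_EFin ?divr_gt0// ln_div.
have mP := measurable_period.
(* The integrals are finite, so their difference is defined and [(2 * pi)^-1] distributes over
   it. *)
rewrite /mean integralB// muleBr// fin_num_adde_defr//.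
exact: integrable_fin_num.
Qed.

Lemma geom_mean_div f1 f2 : log_integrable f1 -> log_integrable f2 ->
  geom_mean (fun t => f1 t / f2 t) = (geom_mean f1 / geom_mean f2)%E.
Proof.
move=> lf1 lf2; rewrite /geom_mean mean_lne_div//.
rewrite -(fineK (mean_fin_num lf1)) -(fineK (mean_fin_num lf2)).
by rewrite /= inver gt_eqF ?expR_gt0// -EFinM -expRN -expRD.
Qed.

(** The quotient [f1 / f2] need not be integrable, so the constant is pulled out by the rule for
    nonnegative functions, which allows the mean to be [+oo]. *)
Lemma meanZl_div f1 f2 (c : R) : 0 <= c -> psd f1 -> psd f2 ->
  log_integrable f1 -> log_integrable f2 ->
  mean (fun t => (c * (f1 t / f2 t))%:E) =
  (c%:E * mean (fun t => (f1 t / f2 t)%:E))%E.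
Proof.
move=> c0 [_ /measurable_int/measurable_EFinP mf1].
move=> [_ /measurable_int/measurable_EFinP mf2] lf1 lf2.
(* the almost everywhere equal [expR (ln f1 - ln f2)] is measurable *)
pose q t := expR (ln (f1 t) - ln (f2 t)).
have qE : {ae mu, forall t, period t -> f1 t / f2 t = q t}.
  apply: (filterS2 (ae_filter_ringOfSetsType mu) _
    (log_integrable_gt0 lf1) (log_integrable_gt0 lf2)) =>
      t + + pt => /(_ pt) p1 /(_ pt) p2.
  by rewrite /q -ln_div// lnK// posrE divr_gt0.
have -> : mean (fun t => (f1 t / f2 t)%:E) = mean (fun t => (q t)%:E).
  apply: mean_ae_eq.
  by apply: (@filterS _ _ (ae_filter_ringOfSetsType mu) _ _ _ qE) => t H /H ->.
have -> : mean (fun t => (c * (f1 t / f2 t))%:E) =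
    mean (fun t => c%:E * (q t)%:E)%E.
  apply: mean_ae_eq.
  by apply: (@filterS _ _ (ae_filter_ringOfSetsType mu) _ _ _ qE) => t H /H ->.
rewrite /mean ge0_integralZl//.
- by rewrite muleCA.
- exact: measurable_period.
- apply/measurable_EFinP; apply: measurableT_comp; first exact: measurable_expR.
  by apply: measurable_funB; apply: measurableT_comp => //; exact: measurable_ln.
- by move=> t _; rewrite lee_fin expR_ge0.
Qed.

End Means.

Theorem mainTheorem7 (R : realType) (f1 f2 : R -> R) (a2 : nat -> R[i])
    (psd_f1 : psd f1) (psd_f2 : psd f2)
    (log_f1 : log_integrable f1) (log_f2 : log_integrable f2)
    (a2_f2 : outer_factor f2 a2) :
  let variance := error_variance f1 (optimal_predictor a2) in
  [/\ variance =
        mean (fun theta : R =>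
          (sqnorm (boundary (powser 0 a2) theta) * f1 theta)%:E),
      variance =
        (mean (fun theta : R => (f1 theta / f2 theta)%R%:E) * geom_mean f2)%E,
      (variance / geom_mean f1)%E = rho_ag f1 f2,
      rho_ag f1 f2 =
        (mean (fun theta : R => (f1 theta / f2 theta)%R%:E)
         * (1 / expeR (mean (fun theta : R => lne (f1 theta / f2 theta)%R%:E))))%E &
      rho_ag f1 f2 =
        (arith_mean (fun theta : R => (f1 theta / f2 theta)%R)
         / geom_mean (fun theta : R => (f1 theta / f2 theta)%R))%E].
Proof.
move=> variance; have [ana _ a0 bd] := a2_f2.
have var1 : variance = mean (fun theta : R =>
    (sqnorm (boundary (powser 0 a2) theta) * f1 theta)%:E).
  apply: mean_ae_eq.
  apply: (@filterS _ _ (ae_filter_ringOfSetsType _) _ _ _ bd) => t H pt.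
  by have [rad _] := H (mem_set pt); rewrite boundary_optimal_predictor.
have var2 : variance =
    (mean (fun theta : R => (f1 theta / f2 theta)%:E) * geom_mean f2)%E.
  rewrite var1 muleC geom_meanE// -meanZl_div ?expR_ge0//.
  apply: mean_ae_eq.
  apply: (filterS2 (ae_filter_ringOfSetsType _) _
    bd (log_integrable_gt0 log_f2)) => t H + pt => /(_ pt) f2_gt0.
  have [_] := H (mem_set pt); rewrite geom_meanE// inver.
  (* A vanishing boundary value would make the factorization read [f2 t = +oo], impossible for a
     real number. *)
  case: eqVneq => [_|b0]; first by rewrite gt0_muley ?lte_fin ?expR_gt0.
  rewrite -EFinM => -[f2E]; congr EFin.
  by rewrite mulrCA [in RHS]f2E invfM invrK mulVKf ?gt_eqF ?expR_gt0// mulrC.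
have geomV : ((geom_mean (fun t => f1 t / f2 t)%R)^-1 =
    geom_mean f2 / geom_mean f1)%E.
  rewrite geom_mean_div// !geom_meanE// !inver !gt_eqF ?expR_gt0//.
  by rewrite -!EFinM inver gt_eqF ?divr_gt0 ?expR_gt0// invfM invrK mulrC.
split => //.
- by rewrite var2 -muleA.
- by rewrite mul1e -/(geom_mean (fun t => f1 t / f2 t)) geomV.
- by rewrite geomV.
Qed.
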